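(* Consider the problem $\min_{y\in\mathbb{R}^n}\phi(y):=f(y)+h(y)$ under the standing assumptions given in the context. When $f$ is convex on $\Omega$, Algorithm mFISTA (described in the context) finds an $\epsilon$-approximate solution of this problem in at most $o(\epsilon^{-2/3})$ iterations; that is, the number $N(\epsilon)$ of iterations until termination with tolerance $\epsilon$ satisfies $N(\epsilon)/\epsilon^{-2/3}\to0$ as $\epsilon\to0^+$.
   Context: **Problem and standing assumptions.** $\Omega\subseteq\mathbb{R}^n$ is a closed convex set. $f$ is a real-valued function on $\mathbb{R}^n$, differentiable with $\|\nabla f(u_1)-\nabla f(u_2)\|\le L\|u_1-u_2\|$ for all $u_1,u_2\in\Omega$, where $L>0$. $h:\mathbb{R}^n\to(-\infty,+\infty]$ is a proper lower semicontinuous convex function (possibly nonsmooth) with $\mathrm{dom}\,h$ closed and bounded, $\mathrm{dom}\,h\subseteq\Omega$, and $\|y\|\le C$ for all $y\in\mathrm{dom}\,h$, where $C>0$ is a constant. $P_\Omega$ denotes the Euclidean projection onto $\Omega$, and $\partial h$ the convex subdifferential. For a differentiable $g$, write $l_g(u_1;u_2):=g(u_2)+\langle\nabla g(u_2),u_1-u_2\rangle$. **$\epsilon$-approximate solution.** A pair $(y,v)$ with $v\in\nabla f(y)+\partial h(y)$ and $\|v\|\le\epsilon$. **Algorithm mFISTA.** Input: $\epsilon>0$, an initial point $x_1=y_0\in\mathrm{dom}\,h$, $a_0=1$, $L_1=0$. For $k=1,2,\dots$: 1. Set $f_k(y)=f(y)+\frac{L_k}{2}\|y-y_{k-1}\|^2$.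 2. Compute $y_k=\operatorname{argmin}_{y\in\mathbb{R}^n}\{l_{f_k}(y;x_k)+h(y)+2L\|y-x_k\|^2\}$. 3. Find $a_k>0$ with $a_k(a_k-1)=a_{k-1}^2$. 4. Compute $v_k=\nabla f(y_k)-\nabla f(x_k)+L_k[y_{k-1}-x_k]+4L[x_k-y_k]$ and $x_{k+1}=P_\Omega\left(y_k+\frac{a_{k-1}-1}{a_k}(y_k-y_{k-1})\right)$. 5. Set $A_k=\frac{2(l_f(y_k;x_{k+1})-f(y_k))}{\|y_k-x_{k+1}\|^2}$ if $y_k\neq x_{k+1}$ and $A_k=0$ otherwise; set $L_{k+1}=\max\{0,A_k\}$. Termination: the algorithm exits at the first $k$ with $\|v_k\|\le\epsilon$ and outputs $(y_k,v_k)$; this $k$ is the number of iterations $N(\epsilon)$. The problem data and the initial point are fixed as $\epsilon\to0^+$. *)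

(* Defs.v *)
From mathcomp Require Import all_boot all_order all_algebra.
From mathcomp Require Import all_classical all_reals all_analysis.

Set Implicit Arguments.
Unset Strict Implicit.
Unset Printing Implicit Defensive.

Import Order.TTheory GRing.Theory Num.Theory numFieldNormedType.Exports.

Local Open Scope classical_set_scope.
Local Open Scope ring_scope.

Section euclidean.
Context {R : realType} {n : nat}.
Implicit Types (u v : 'rV[R]_n) (g : 'rV[R]_n -> R).

Definition dot u v : R := \sum_(i < n) u ord0 i * v ord0 i.

(* The library norm on 'rV[R]_n is the sup norm; it induces the same topology
   but it is not the norm used in the estimates. *)
Definition enorm u : R := Num.sqrt (dot u u).

(* The vector of partial derivatives; meaningful where g is differentiable. *)
Definition grad g u : 'rV[R]_n :=
  \row_(i < n) 'D_(delta_mx ord0 i) (g : 'rV[R]_n -> R^o) u.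

(* l_g(u; v), the linearization of g at v evaluated at u. *)
Definition linearization g u v : R := g v + dot (grad g v) (u - v).

(* [get] chooses an element of the set; here and in [proj] the set is a
   singleton wherever the algorithm uses it. *)
Definition argmin (F : 'rV[R]_n -> \bar R) : 'rV[R]_n :=
  get [set y | forall z, (F y <= F z)%E].

Definition proj (Omega : set 'rV[R]_n) u : 'rV[R]_n :=
  get [set y | Omega y /\ forall z, Omega z -> enorm (u - y) <= enorm (u - z)].

End euclidean.

Section convex_analysis.
Context {R : realType} {n : nat}.
Implicit Types (h : 'rV[R]_n -> \bar R) (y v : 'rV[R]_n).

Definition edom h : set 'rV[R]_n := [set y | (h y < +oo)%E].

Definition eproper h := (forall y, (-oo < h y)%E) /\ edom h !=set0.

(* For a function that never takes the value -oo the right-hand side is never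
   of the form +oo - oo, and 0 * +oo = 0. *)
Definition econvex h := forall (t : {i01 R}) (x y : 'rV[R]_n),
  (h (t%:num *: x + (1 - t%:num) *: y)%R
     <= (t%:num)%:E * h x + (1 - t%:num)%R%:E * h y)%E.

(* If h is proper and h y = +oo then this set is empty. *)
Definition subdiff h y : set 'rV[R]_n :=
  [set u | forall z, (h y + (dot u (z - y)%R)%:E <= h z)%E].

Definition approx_solution (f : 'rV[R]_n -> R) h (eps : R) y v :=
  [set grad f y + u | u in subdiff h y] v /\ enorm v <= eps.

End convex_analysis.

Record problem_assumptions {R : realType} {n : nat} (Omega : set 'rV[R]_n)
    (f : 'rV[R]_n -> R) (h : 'rV[R]_n -> \bar R) (L C : R) : Prop := {
  Omega_closed : closed Omega ;
  Omega_convex : convex_set (Omega : set (convex_lmodType 'rV[R]_n)) ;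
  f_differentiable : forall u, differentiable (f : 'rV[R]_n -> R^o) u ;
  L_gt0 : 0 < L ;
  grad_lipschitz : forall u1 u2, Omega u1 -> Omega u2 ->
    enorm (grad f u1 - grad f u2) <= L * enorm (u1 - u2) ;
  h_proper : eproper h ;
  h_lsc : lower_semicontinuous h ;
  h_convex : econvex h ;
  dom_closed : closed (edom h) ;
  dom_bounded : bounded_set (edom h) ;
  dom_subset : edom h `<=` Omega ;
  C_gt0 : 0 < C ;
  dom_norm_le : forall y, edom h y -> enorm y <= C }.

Section mFISTA.
Context {R : realType} {n : nat}.
Variables (Omega : set 'rV[R]_n) (f : 'rV[R]_n -> R) (h : 'rV[R]_n -> \bar R).
Variables (L : R) (y0 : 'rV[R]_n).

(* The data available when iteration k starts; the first one has k = 1. *)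
Record mfista_state := MfistaState {
  st_x : 'rV[R]_n ; (* x_k *)
  st_y : 'rV[R]_n ; (* y_(k-1) *)
  st_a : R ;        (* a_(k-1) *)
  st_L : R          (* L_k *) }.

Definition mfista_init : mfista_state := MfistaState y0 y0 1 0.

Section iteration.
Variable s : mfista_state.

Definition step_f (y : 'rV[R]_n) : R :=
  f y + st_L s / 2 * enorm (y - st_y s) ^+ 2.

Definition step_y : 'rV[R]_n :=
  argmin (fun y => (linearization step_f y (st_x s))%:E + h y
                   + (2 * L * enorm (y - st_x s) ^+ 2)%R%:E)%E.

Definition step_a : R := get [set a : R | 0 < a /\ a * (a - 1) = st_a s ^+ 2].

Definition step_v : 'rV[R]_n :=
  grad f step_y - grad f (st_x s) + st_L s *: (st_y s - st_x s)
  + (4 * L) *: (st_x s - step_y).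

Definition step_x : 'rV[R]_n :=
  proj Omega (step_y + ((st_a s - 1) / step_a) *: (step_y - st_y s)).

Definition step_A : R :=
  if step_y == step_x then 0
  else 2 * (linearization f step_y step_x - f step_y)
       / enorm (step_y - step_x) ^+ 2.

Definition mfista_step : mfista_state :=
  MfistaState step_x step_y step_a (Num.max 0 step_A).

End iteration.

(* The tolerance only enters the stopping test, so the iterates are defined
   for all k >= 1 independently of it. *)
Definition mfista_before (k : nat) : mfista_state :=
  iter k.-1 mfista_step mfista_init.

Definition mfista_y (k : nat) : 'rV[R]_n := step_y (mfista_before k).

Definition mfista_v (k : nat) : 'rV[R]_n := step_v (mfista_before k).

(* The run with tolerance eps exits at iteration N. *)
Definition mfista_exits_at (eps : R) (N : nat) :=
  [/\ (1 <= N)%N, enorm (mfista_v N) <= eps &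
      forall k, (1 <= k < N)%N -> eps < enorm (mfista_v k)].

End mFISTA.

(* Main.v *)
(** Convexity of [f] makes every curvature estimate [A_k] nonpositive, so that
    [L_k = 0] throughout and mFISTA is FISTA with proximal parameter [4 L].
    Since this exceeds [L], the usual FISTA energy
    [a_k^2 (phi y_(k+1) - phi z) + 2 L |z - u_(k+1)|^2], with [z] a minimizer and
    [u_(k+1) = y_k + a_k (y_(k+1) - y_k)], decreases at each iteration by at
    least [(3 L / 2) a_k^2 |y_(k+1) - x_(k+1)|^2]. As [a_k >= 1 + k / 2] and
    [|v_k| <= 5 L |y_k - x_k|], the series of the [k^2 |v_k|^2] converges; if
    [|v_k| > eps] for all [k < N], the partial sum between [m] and [N] exceeds
    [(N^3 - m^3) eps^2 / 3], and it is arbitrarily small once [m] is large. Hence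
    [N^3 eps^2 -> 0]. *)
Require Import Defs.
From mathcomp Require Import all_boot all_order all_algebra.
From mathcomp Require Import all_classical all_reals all_analysis.
From mathcomp Require Import ring lra.
Import Order.TTheory GRing.Theory Num.Theory numFieldNormedType.Exports.
Local Open Scope classical_set_scope.
Local Open Scope ring_scope.

(** * Euclidean inner product and norm *)

Section euclidean_norm.
Context {R : realType} {n : nat}.
Implicit Types (u v w : 'rV[R]_n) (a : R).

Lemma dotC u v : dot u v = dot v u.
Proof. by apply: eq_bigr => i _; rewrite mulrC. Qed.

Lemma dotDl u v w : dot (u + v) w = dot u w + dot v w.
Proof. by rewrite -big_split; apply: eq_bigr => i _; rewrite mxE mulrDl. Qed.

Lemma dotZl a u v : dot (a *: u) v = a * dot u v.
Proof. by rewrite mulr_sumr; apply: eq_bigr => i _; rewrite mxE mulrA. Qed.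

Lemma dotNl u v : dot (- u) v = - dot u v.
Proof. by rewrite -scaleN1r dotZl mulN1r. Qed.

Lemma dotDr u v w : dot u (v + w) = dot u v + dot u w.
Proof. by rewrite dotC dotDl !(dotC _ u). Qed.

Lemma dotZr a u v : dot u (a *: v) = a * dot u v.
Proof. by rewrite dotC dotZl dotC. Qed.

Lemma dotNr u v : dot u (- v) = - dot u v.
Proof. by rewrite dotC dotNl dotC. Qed.

Definition dotE := (dotDl, dotDr, dotNl, dotNr, dotZl, dotZr).

Lemma dotvv_ge0 u : 0 <= dot u u.
Proof. by apply: sumr_ge0 => i _; rewrite -expr2 sqr_ge0. Qed.

Lemma enorm_ge0 u : 0 <= enorm u.
Proof. exact: sqrtr_ge0. Qed.

Lemma sqr_enorm u : enorm u ^+ 2 = dot u u.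
Proof. by rewrite sqr_sqrtr// dotvv_ge0. Qed.

Lemma enormZ a u : enorm (a *: u) = `|a| * enorm u.
Proof. by rewrite /enorm dotZl dotZr mulrA -expr2 sqrtrM ?sqr_ge0// sqrtr_sqr. Qed.

(** Cauchy-Schwarz: the quadratic [|a u + v|^2] in [a] is nonnegative, in particular at its
    vertex. *)
Lemma dot_le_enorm u v : dot u v <= enorm u * enorm v.
Proof.
have q a : 0 <= dot u u * a ^+ 2 + dot u v * a *+ 2 + dot v v.
  have := dotvv_ge0 (a *: u + v); rewrite !dotE (dotC v u); nra.
have [uv0|uv0] := leP (dot u v) 0.
  by rewrite (le_trans uv0)// mulr_ge0// enorm_ge0.
have uu : 0 < dot u u.
  rewrite lt_neqAle dotvv_ge0 andbT eq_sym; apply/eqP => uu0.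
  (* If [dot u u = 0], the quadratic is affine in [a] and equals [- dot v v - 2] at this point. *)
  have := q (- (dot v v + 1) / dot u v); rewrite uu0.
  have -> : dot u v * (- (dot v v + 1) / dot u v) = - (dot v v + 1).
    by field; rewrite gt_eqF.
  have := dotvv_ge0 v; lra.
rewrite -ler_sqr ?nnegrE ?(ltW uv0)// ?mulr_ge0 ?enorm_ge0//.
rewrite exprMn !sqr_enorm.
have := q (- dot u v / dot u u).
have -> : dot u u * (- dot u v / dot u u) ^+ 2 + dot u v * (- dot u v / dot u u) *+ 2
  + dot v v = (dot u u * dot v v - dot u v ^+ 2) / dot u u.
  by field; rewrite gt_eqF.
by rewrite pmulr_lge0 ?invr_gt0// subr_ge0.
Qed.

Lemma ler_enormD u v : enorm (u + v) <= enorm u + enorm v.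
Proof.
rewrite -ler_sqr ?nnegrE ?addr_ge0 ?enorm_ge0// sqrrD !sqr_enorm.
rewrite !dotE (dotC v u); have := dot_le_enorm u v; lra.
Qed.

(** Boundedness, hence compactness, refers to the sup norm; this carries Euclidean bounds over to
    it. *)
Lemma ler_norm_enorm u : `|u| <= enorm u.
Proof.
rewrite [`|u|]/Num.norm/= mx_normrE; apply: bigmax_le => [|[i j] _ /=].
  exact: enorm_ge0.
rewrite (ord1 i) -ler_sqr ?nnegrE ?enorm_ge0// sqr_enorm real_normK ?num_real//.
by rewrite /dot (bigD1 j)//= -expr2 lerDl sumr_ge0// => k _; rewrite -expr2 sqr_ge0.
Qed.

Lemma dot_continuous (T : topologicalType) (F G : T -> 'rV[R]_n) :
  continuous F -> continuous G -> continuous (fun x => dot (F x) (G x)).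
Proof.
move=> cF cG x; apply: cvg_big => [|i _]; first exact: add_continuous.
by apply: cvgM; apply: (@continuous_comp _ _ _ _ (fun u : 'rV[R]_n => u ord0 i));
  [exact: cF|exact: coord_continuous|exact: cG|exact: coord_continuous].
Qed.

Lemma enorm_continuous (T : topologicalType) (F : T -> 'rV[R]_n) :
  continuous F -> continuous (fun x => enorm (F x)).
Proof.
move=> cF x; apply: (@continuous_comp _ _ _ (fun x => dot (F x) (F x)) Num.sqrt).
  exact: dot_continuous.
exact: sqrt_continuous.
Qed.

End euclidean_norm.

(** * Lower semicontinuity and minimizers on compact sets *)

Section lower_semicontinuity.
Context {R : realType} {T : topologicalType}.

Lemma lsc_addr (h : T -> \bar R) (g : T -> R) :
  lower_semicontinuous h -> continuous g ->
  lower_semicontinuous (fun x => h x + (g x)%:E)%E.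
Proof.
move=> lh cg x a ahg.
(* The slack [e] pays for the drop of [g] near [x]; half of the excess over [a] serves when [h x] is
   finite. *)
have [e e0 he] : exists2 e : R, 0 < e & ((a - g x + e)%:E < h x)%E.
  move: ahg; case: (h x) => [r| |]//=.
    rewrite -EFinD lte_fin => ?.
    by exists ((r + g x - a) / 2); rewrite ?lte_fin; lra.
  by exists 1; rewrite ?ltry.
have [V Vx hV] := lh x _ he.
exists (V `&` [set y | g x - e < g y]).
  apply: filterI => //; apply: (cvgr_gt _ (cg x)); lra.
move=> y [/hV]; rewrite /=; case: (h y) => [r| |]//=.
  by rewrite -EFinD !lte_fin; lra.
by move=> _ _; rewrite addye// ltry.
Qed.

(* The sublevel sets of the values taken on K generate a filter on K; any of
   its cluster points is a minimizer. *)
Lemma lsc_compact_min (K : set T) (F : T -> \bar R) :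
  K !=set0 -> compact K -> lower_semicontinuous F ->
  exists2 c, K c & forall t, K t -> (F c <= F t)%E.
Proof.
move=> [t0 Kt0] cK lF.
pose S t := [set x | K x /\ (F x <= F t)%E].
pose G : set_system T := [set A | exists2 t, K t & S t `<=` A].
have GF : ProperFilter G.
  split; first by move=> [t Kt /(_ t)]; apply; split.
  split; first by exists t0.
  - move=> A B [t Kt tA] [s Ks sB].
    have [ts|st] := leP (F t) (F s).
      by exists t => // x [Kx xt]; split;
        [apply: tA|apply: sB; split=> //; exact: le_trans ts].
    by exists s => // x [Kx xs]; split;
      [apply: tA; split=> //; exact: le_trans (ltW st)|apply: sB].
  - by move=> A B AB [t Kt tA]; exists t => // x /tA /AB.
have [p [Kp clp]] : K `&` cluster G !=set0 by apply: cK; exists t0 => // x [].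
exists p => // t Kt; rewrite leNgt; apply/negP => tp.
have [a ta ap] : exists2 a : R, (F t <= a%:E)%E & (a%:E < F p)%E.
  move: tp; case: (F t) => [r| |]//.
  - by exists r.
  - by rewrite ltNge leey.
  case: (F p) => [q| |]// _.
    by exists (q - 1); rewrite ?leNye// lte_fin ltrBlDr ltrDl.
  by exists 0; rewrite ?leNye ?ltry.
have [V Vp FV] := lF p a ap.
have [x [[_ xt] Vx]] : S t `&` V !=set0 by apply: clp => //; exists t.
by have := lt_le_trans (FV x Vx) (le_trans xt ta); rewrite ltxx.
Qed.

End lower_semicontinuity.

(** * Derivatives along lines *)

Section line_derivatives.
Context {R : realType} {n : nat}.
Implicit Types (f : 'rV[R]_n -> R) (x d : 'rV[R]_n).

Lemma derive_grad f x d : differentiable (f : 'rV[R]_n -> R^o) x ->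
  'D_d (f : 'rV[R]_n -> R^o) x = dot (grad f x) d.
Proof.
move=> df; rewrite deriveE// {1}(row_sum_delta d) linear_sum.
apply: eq_bigr => i _; rewrite linearZ /= mxE -deriveE//.
by rewrite mulrC.
Qed.

Lemma is_derive_line f x d (t : R) :
  differentiable (f : 'rV[R]_n -> R^o) (x + t *: d) ->
  is_derive t 1 (fun t => f (x + t *: d) : R^o) (dot (grad f (x + t *: d)) d).
Proof.
move=> df.
have E : (fun e : R => e^-1 *: (((fun t => f (x + t *: d) : R^o) \o shift t) (e *: 1)
    - f (x + t *: d)))
  = (fun e : R => e^-1 *: (((f : 'rV[R]_n -> R^o) \o shift (x + t *: d)) (e *: d)
    - f (x + t *: d))).
  apply/funext => e /=; congr (_ *: (f _ - _)).
  by rewrite [e *: 1]mulr1 scalerDl addrCA.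
split; first by rewrite /derivable E; exact: diff_derivable.
by rewrite -derive_grad// /derive E.
Qed.

End line_derivatives.
(** The first-order part of a minimality condition along a segment. Were [A] negative,
    [t = - A / (B + 1 - A)] would already give a negative value, so no limit is taken. *)
Lemma ge0_linear_coef {R : realFieldType} (A B : R) : 0 <= B ->
  (forall t, 0 < t -> t <= 1 -> 0 <= t * A + t ^+ 2 * B) -> 0 <= A.
Proof.
move=> B0 H; rewrite leNgt; apply/negP => A0.
have D0 : 0 < B + 1 - A by lra.
have t0 : 0 < - A / (B + 1 - A) by rewrite divr_gt0//; lra.
have := H _ t0; rewrite ler_pdivrMr//.
have -> : - A / (B + 1 - A) * A + (- A / (B + 1 - A)) ^+ 2 * B
  = - (A / (B + 1 - A)) ^+ 2 * (1 - A) by field; lra.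
have t1 : - A <= 1 * (B + 1 - A) by lra.
move=> /(_ t1); apply/negP; rewrite -ltNge mulNr oppr_lt0.
apply: mulr_gt0; last by lra.
by rewrite exprn_even_gt0//= mulf_neq0 ?invr_eq0; lra.
Qed.

(** * First-order bounds for convex and for smooth functions *)

Section convex_sets_and_functions.
Context {R : realType} {n : nat}.
Implicit Types (Omega : set 'rV[R]_n) (f : 'rV[R]_n -> R) (x y z u : 'rV[R]_n).

Lemma convex_set_segment Omega x z (t : R) :
  convex_set (Omega : set (convex_lmodType 'rV[R]_n)) -> Omega x -> Omega z ->
  0 <= t -> t <= 1 -> Omega (x + t *: (z - x)).
Proof.
move=> cO Ox Oz t0 t1.
have := cO z x (Itv01 t0 t1) (mem_set Oz) (mem_set Ox) => /set_mem.
rewrite /conv/= /unstable.onem scalerBl scale1r.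
by congr Omega; rewrite scalerBr addrCA addrA.
Qed.

(** By convexity each difference quotient from [x] towards [z] is at most [f z - f x]; the
    directional derivative is their limit from the right. *)
Lemma linearization_le Omega f x z :
  @convex_function R 'rV[R]_n Omega f -> differentiable (f : 'rV[R]_n -> R^o) x ->
  Omega x -> Omega z -> linearization f z x <= f z.
Proof.
move=> cf df Ox Oz; rewrite /linearization -derive_grad// addrC -lerBrDr.
have /cvg_dnbhs_at_right cv : derivable (f : 'rV[R]_n -> R^o) x (z - x) by exact: diff_derivable.
apply: (@cvgr_to_le _ (0^'+) _ R _ _ _ cv).
near=> t.
have t0 : 0 < t by [].
have t1 : t <= 1 by near: t; apply: nbhs_right_le.
have := cf (Itv01 (ltW t0) t1) z x (mem_set Oz) (mem_set Ox).
rewrite convRE {1}/conv/= /unstable.onem.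
have -> : t *: z + (1 - t) *: x = t *: (z - x) + x :> 'rV_n.
  by rewrite scalerBl scale1r scalerBr addrCA addrC.
by move=> ?; rewrite ler_pdivrMl//; lra.
Unshelve. all: by end_near. Qed.

(** Mean value theorem for [f] along the segment minus the quadratic bound: the derivative of the
    difference is nonpositive by Cauchy-Schwarz and the Lipschitz condition, the segment staying in
    [Omega]. *)
Lemma descent_lemma Omega f (L : R) x y :
  convex_set (Omega : set (convex_lmodType 'rV[R]_n)) ->
  (forall u, differentiable (f : 'rV[R]_n -> R^o) u) ->
  (forall u1 u2, Omega u1 -> Omega u2 ->
    enorm (grad f u1 - grad f u2) <= L * enorm (u1 - u2)) ->
  Omega x -> Omega y -> f y <= linearization f y x + L / 2 * enorm (y - x) ^+ 2.
Proof.
move=> cO df lip Ox Oy; rewrite /linearization.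
set d := y - x; set p := dot _ _; set D := enorm d ^+ 2.
pose g (t : R) : R^o := f (x + t *: d) - (t * p + t ^+ 2 * (L / 2 * D)).
have dg (t : R) : is_derive t 1 g (dot (grad f (x + t *: d)) d - (p + t * (L * D))).
  have ? := is_derive_line f x d t (df _).
  apply: is_deriveB; apply: is_derive_eq.
  by rewrite !scaler0 !add0r /GRing.scale/=; field.
have cg : {within `[0, 1], continuous g}.
  by apply: derivable_within_continuous => t _; exact: ex_derive.
have [c c01] := MVT_segment ler01 (fun t _ => dg t) cg.
rewrite /g scale1r scale0r addr0 mul0r expr0n/= mul0r addr0 !subr0 mulr1.
rewrite (_ : x + d = y); last by rewrite /d addrC subrK.
move: c01; rewrite in_itv/= => /andP[c0 c1].
have Oc : Omega (x + c *: d) by exact: convex_set_segment.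
have : dot (grad f (x + c *: d) - grad f x) d <= c * (L * D).
  apply: le_trans (dot_le_enorm _ _) _.
  have := lip _ _ Oc Ox; rewrite addrAC subrr add0r enormZ ger0_norm// => h.
  have := ler_wpM2r (enorm_ge0 d) h.
  by rewrite /D expr2 !mulrA (mulrC c).
by rewrite dotDl dotNl -/p => ?; lra.
Qed.

End convex_sets_and_functions.

(** * Existence and optimality condition of the proximal step *)

Section proximal_step.
Context {R : realType} {n : nat}.
Implicit Types (h : 'rV[R]_n -> \bar R) (x y z g : 'rV[R]_n).

Let model h (b c : R) g x z : \bar R :=
  ((b + dot g (z - x))%R%:E + h z + (c * enorm (z - x) ^+ 2)%R%:E)%E.

(** The objective is lower semicontinuous and equals [+oo] off the compact domain of [h], so a
    minimizer exists and [argmin] selects one; its value is finite since that at [y0] is. *)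
Lemma argmin_model h b c g x :
  eproper h -> lower_semicontinuous h -> compact (edom h) ->
  edom h (argmin (model h b c g x)) /\
  forall z, (model h b c g x (argmin (model h b c g x)) <= model h b c g x z)%E.
Proof.
move=> [hNy [y0 hy0]] lh ch.
pose q z := (b + dot g (z - x)) + c * enorm (z - x) ^+ 2.
have modelE z : model h b c g x z = (h z + (q z)%:E)%E.
  by rewrite /model (addeC _ (h z)) -addeA -EFinD.
have cid : continuous (fun z => z - x).
  by move=> z; apply: continuousB; [move=> ?|exact: cst_continuous].
have cq : continuous q.
  move=> z.
  apply: (@continuousD _ R^o _ (fun z => b + dot g (z - x)) (fun z => c * enorm (z - x) ^+ 2)).
    apply: (@continuousD _ R^o _ (fun=> b)); first exact: cst_continuous.
    by apply: (dot_continuous _ (fun=> g)) => //; exact: cst_continuous.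
  apply: (@continuousM _ _ (fun=> c)); first exact: cst_continuous.
  by apply: continuousM; exact: enorm_continuous.
have [y dy ymin] := lsc_compact_min _ _ (ex_intro _ y0 hy0) ch (lsc_addr _ _ lh cq).
have minP : forall z, (model h b c g x (argmin (model h b c g x)) <= model h b c g x z)%E.
  apply: (@getPex _ [set u | forall z, (model h b c g x u <= model h b c g x z)%E]).
  exists y => z; rewrite !modelE.
  have [/ymin//|] := pselect (edom h z).
  by move/negP; rewrite -leNgt leye_eq => /eqP ->; rewrite addye// leey.
split => //.
have : (model h b c g x (argmin (model h b c g x)) < +oo)%E.
  apply: le_lt_trans (minP y0) _; rewrite modelE.
  by move: hy0; rewrite /edom/=; case: (h y0) => [r _||]; rewrite -?EFinD ?ltry.
rewrite modelE /edom/=.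
by case: (h _) (hNy (argmin (model h b c g x))).
Qed.

(* Compare y with the points of the segment [y, z] and let them tend to y. *)
Lemma model_min_subdiff h b c g x y :
  eproper h -> econvex h -> 0 <= c -> edom h y ->
  (forall z, (model h b c g x y <= model h b c g x z)%E) ->
  subdiff h y ((2 * c) *: (x - y) - g).
Proof.
move=> [hNy _] ch c0 dy ymin z.
case Ez : (h z) (hNy z) => [r| |]// _; last by rewrite leey.
move: dy; rewrite /edom/=; case Ey : (h y) (hNy y) => [s| |]// _ _.
rewrite -EFinD lee_fin -subr_ge0.
(* [A] is the gap in the subgradient inequality; minimality of [y] against [w] below leaves
   [0 <= t A + t^2 c |z - y|^2]. *)
set A := (X in 0 <= X).
apply: (ge0_linear_coef _ (c * dot (z - y) (z - y))).
  by rewrite mulr_ge0// dotvv_ge0.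
move=> t t0 t1; pose w := y + t *: (z - y).
have := ch (Itv01 (ltW t0) t1) z y.
rewrite Ez Ey/= (_ : t *: z + (1 - t) *: y = w); last first.
  by rewrite /w scalerBl scale1r scalerBr addrCA addrA.
have := ymin w; rewrite /model Ey.
case: (h w) (hNy w) => [q| |]// _.
rewrite -!EFinM -!EFinD !lee_fin !sqr_enorm.
have -> : w - x = (y - x) + t *: (z - y) by rewrite /w addrAC.
rewrite /A; move: (z - y) => e.
rewrite -(opprB y x); move: (y - x) => d.
rewrite !dotE (dotC e d); lra.
Qed.

Lemma subdiff_le h y u z : eproper h -> edom h y -> edom h z -> subdiff h y u ->
  fine (h y) + dot u (z - y) <= fine (h z).
Proof.
move=> [hNy _]; rewrite /edom/= => dy dz /(_ z).
case: (h y) (hNy y) dy => [s| |]// _ _.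
by case: (h z) (hNy z) dz => [r| |]// _ _; rewrite -EFinD lee_fin.
Qed.

Lemma econvex_segment h x z (t : R) : eproper h -> econvex h ->
  edom h x -> edom h z -> 0 <= t -> t <= 1 ->
  edom h (t *: z + (1 - t) *: x) /\
  fine (h (t *: z + (1 - t) *: x)) <= t * fine (h z) + (1 - t) * fine (h x).
Proof.
move=> [hNy _] ch; rewrite /edom/= => dx dz t0 t1.
have := ch (Itv01 t0 t1) z x => /=.
case: (h x) (hNy x) dx => [s| |]// _ _.
case: (h z) (hNy z) dz => [r| |]// _ _.
rewrite -!EFinM -EFinD.
by case: (h _) (hNy (t *: z + (1 - t) *: x)) => [q| |]// _; rewrite ?lee_fin ?ltry.
Qed.

End proximal_step.

(** * Euclidean projection onto a closed convex set *)

Section projection.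
Context {R : realType} {n : nat}.
Implicit Types (Omega : set 'rV[R]_n) (u z : 'rV[R]_n).

(** [Omega] may be unbounded, so the distance is minimized over the compact part [K] no farther from
    [u] than a reference point. *)
Lemma proj_closest Omega u : closed Omega -> Omega !=set0 ->
  Omega (Defs.proj Omega u) /\
  forall z, Omega z -> enorm (u - Defs.proj Omega u) <= enorm (u - z).
Proof.
move=> clO [z0 Oz0].
have cn : continuous (fun z => enorm (u - z)).
  apply: enorm_continuous => z.
  by apply: continuousB; [exact: cst_continuous|move=> ?].
pose K := Omega `&` [set z | enorm (u - z) <= enorm (u - z0)].
have Kz0 : K z0 by split => /=.
have cK : compact K.
  apply: bounded_closed_compact.
    exists (enorm u + enorm (u - z0)); split=> [|M /ltW uM z [_ /= uz]].
      exact: num_real.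
    apply: le_trans uM.
    rewrite -[z](subKr u); apply: le_trans (ler_normB _ _) _; apply: lerD.
      exact: ler_norm_enorm.
    exact: le_trans (ler_norm_enorm _) uz.
  apply: closedI => //.
  apply: (@closed_comp _ _ (fun z => enorm (u - z)) [set r | r <= enorm (u - z0)]).
    by move=> z _; exact: cn.
  exact: closed_le.
have [p /set_mem[Op up] pmin] := EVT_min_rV (ex_intro _ z0 Kz0) cK
  (continuous_subspaceT cn).
apply: (@getPex _ [set y | Omega y /\ forall z, Omega z -> enorm (u - y) <= enorm (u - z)]).
exists p; split=> // z Oz.
have [zu|/ltW zu] := leP (enorm (u - z)) (enorm (u - z0)).
  by apply: pmin; apply: mem_set.
exact: le_trans zu.
Qed.

(** Minimality along the segment from the projection [p] to [z] gives [0 <= dot (z - p) (p - u)];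
    expanding [|z - u|^2] around [p] then suffices. *)
Lemma proj_nonexpansive Omega u z :
  convex_set (Omega : set (convex_lmodType 'rV[R]_n)) -> closed Omega ->
  Omega z -> enorm (z - Defs.proj Omega u) ^+ 2 <= enorm (z - u) ^+ 2.
Proof.
move=> cO clO Oz; have [] := proj_closest _ u clO (ex_intro _ z Oz).
set p := Defs.proj Omega u => Op pmin.
suff : 0 <= 2 * dot (z - p) (p - u).
  have -> : z - u = (z - p) + (p - u) by rewrite addrA subrK.
  rewrite !sqr_enorm; move: (z - p) => e; move: (p - u) => d.
  rewrite !dotE (dotC d e); have := dotvv_ge0 d; lra.
apply: (ge0_linear_coef _ (dot (z - p) (z - p))); first exact: dotvv_ge0.
move=> t t0 t1.
have := pmin _ (convex_set_segment _ _ _ t cO Op Oz (ltW t0) t1).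
rewrite -ler_sqr ?nnegrE ?enorm_ge0// !sqr_enorm.
rewrite opprD addrA; rewrite -(opprB p u).
move: (z - p) => e; move: (p - u) => d.
rewrite !dotE (dotC e d); lra.
Qed.

End projection.

(** * Energy estimates for mFISTA with convex [f] *)

Section mfista_convex.
Context {R : realType} {n : nat}.
Context {Omega : set 'rV[R]_n} {f : 'rV[R]_n -> R} {h : 'rV[R]_n -> \bar R}.
Context {L C : R} {y0 : 'rV[R]_n}.
Context (assumptions : problem_assumptions Omega f h L C).
Context (f_convex : @convex_function R 'rV[R]_n Omega f).
Context (y0_dom : edom h y0).
Implicit Types (s : @mfista_state R n) (u z : 'rV[R]_n).

Let step := mfista_step Omega f h L.
(** [fine] sends [+oo] to 0, so this is the objective only on [edom h], where it is evaluated
    below. *)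
Let phi z := f z + fine (h z).

Let dom_compact : compact (edom h).
Proof.
exact: bounded_closed_compact (dom_bounded assumptions) (dom_closed assumptions).
Qed.

Let dOmega z : edom h z -> Omega z.
Proof. exact: (dom_subset assumptions). Qed.

Lemma minimizer_exists : exists2 z, edom h z & forall y, edom h y -> phi z <= phi y.
Proof.
have cf : continuous f.
  by move=> x; exact: differentiable_continuous (f_differentiable assumptions x).
have [z dz zmin] := lsc_compact_min _ _ (ex_intro _ y0 y0_dom) dom_compact
  (lsc_addr _ _ (h_lsc assumptions) cf).
exists z => // y dy; have := zmin y dy; rewrite /phi; move: dz dy; rewrite /edom/=.
have [hNy _] := h_proper assumptions.
case: (h z) (hNy z) => [r| |]// _ _.
case: (h y) (hNy y) => [s| |]// _ _.
by rewrite -!EFinD lee_fin ![_ + f _]addrC.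
Qed.

(** The extrapolated point is kept in [Omega] only, where the gradient bounds hold; the proximal
    points stay in the domain of [h]. *)
Definition mfista_inv s :=
  [/\ Omega (st_x s), edom h (st_y s), 1 <= st_a s & st_L s = 0].

Lemma step_y_prox s : mfista_inv s ->
  edom h (step_y f h L s) /\
  subdiff h (step_y f h L s) ((4 * L) *: (st_x s - step_y f h L s) - grad f (st_x s)).
Proof.
move=> [_ _ _ L0].
have sf : step_f f s = f by apply/funext => y; rewrite /step_f L0 mul0r mul0r addr0.
have [dy ymin] := argmin_model h (f (st_x s)) (2 * L) (grad f (st_x s)) (st_x s)
  (h_proper assumptions) (h_lsc assumptions) dom_compact.
have -> : step_y f h L s = argmin (fun z => ((f (st_x s) + dot (grad f (st_x s))
    (z - st_x s))%R%:E + h z + (2 * L * enorm (z - st_x s) ^+ 2)%R%:E)%E).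
  by rewrite /step_y sf.
split=> //; have -> : 4 * L = 2 * (2 * L) by ring.
apply: model_min_subdiff dy ymin; first exact: h_proper assumptions.
  exact: h_convex assumptions.
by rewrite mulr_ge0// ltW// (L_gt0 assumptions).
Qed.

(** Sum of convexity of [f] at [z], the descent lemma from [x] to the new point, and the subgradient
    inequality for [h]. The gain [3 L / 2] is [2 L - L / 2]. *)
Lemma prox_inequality s z : mfista_inv s -> edom h z ->
  phi (step_y f h L s) + 3 * L / 2 * enorm (step_y f h L s - st_x s) ^+ 2
    + 2 * L * enorm (z - step_y f h L s) ^+ 2
  <= phi z + 2 * L * enorm (z - st_x s) ^+ 2.
Proof.
move=> si dz; have [dy sub] := step_y_prox s si; have [Ox _ _ _] := si.
have := linearization_le _ _ _ _ f_convex (f_differentiable assumptions (st_x s))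
  Ox (dOmega _ dz).
have := descent_lemma _ _ _ _ _ (Omega_convex assumptions)
  (f_differentiable assumptions) (grad_lipschitz assumptions) Ox (dOmega _ dy).
have := subdiff_le _ _ _ _ (h_proper assumptions) dy dz sub.
rewrite /linearization /phi.
move: (step_y f h L s) (st_x s) => y x.
have -> : z - x = (z - y) + (y - x) by rewrite addrA subrK.
rewrite -(opprB y x) !sqr_enorm.
move: (z - y) (y - x) (grad f x) => e d g.
rewrite !dotE (dotC e d) => *; lra.
Qed.

(** Completing the square, [(b - 1/2)^2 = a^2 + 1/4] for the new value [b], whence growth by at
    least one half. *)
Lemma step_aP s : 1 <= st_a s ->
  step_a s * (step_a s - 1) = st_a s ^+ 2 /\ st_a s + 2^-1 <= step_a s.
Proof.
move=> a1.
have [a0 aE] : 0 < step_a s /\ step_a s * (step_a s - 1) = st_a s ^+ 2.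
  apply: (@getPex _ [set a : R | 0 < a /\ a * (a - 1) = st_a s ^+ 2]).
  pose q := Num.sqrt (1 + 4 * st_a s ^+ 2).
  have q2 : q ^+ 2 = 1 + 4 * st_a s ^+ 2.
    by rewrite sqr_sqrtr// addr_ge0// mulr_ge0// sqr_ge0.
  exists ((1 + q) / 2); split; last by nra.
  by rewrite divr_gt0// ltr_wpDr// sqrtr_ge0.
split=> //; rewrite leNgt; apply/negP => ?; nra.
Qed.

Lemma mfista_inv_init : mfista_inv (mfista_init y0).
Proof. by split=> //=; exact: dOmega. Qed.

Lemma mfista_inv_step s : mfista_inv s -> mfista_inv (step s).
Proof.
move=> si; have [dy _] := step_y_prox s si; have [Ox _ a1 _] := si.
have [Op _] := proj_closest Omega (step_y f h L s + ((st_a s - 1) / step_a s) *: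
  (step_y f h L s - st_y s)) (Omega_closed assumptions) (ex_intro _ _ Ox).
split=> //=; first by have [_] := step_aP s a1; lra.
(* The linearization of a convex [f] lies below [f], so [A_k <= 0] and the maximum with 0
   vanishes. *)
apply/max_idPl; rewrite /step_A; case: ifP => // _.
rewrite mulr_le0_ge0 ?invr_ge0 ?sqr_ge0// pmulr_rle0// subr_le0.
apply: linearization_le f_convex _ Op (dOmega _ dy).
exact: f_differentiable assumptions _.
Qed.

(* The extrapolation rule is chosen so that the left-hand vector equals
   (z - u) / a before projecting, u being the auxiliary sequence of FISTA. *)
Let linked s u z := enorm ((st_a s)^-1 *: z + (1 - (st_a s)^-1) *: st_y s - st_x s) ^+ 2
  <= (enorm (z - u) / st_a s) ^+ 2.

Let next_u s := st_y s + st_a s *: (step_y f h L s - st_y s).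

(** The convex combination of [z] and the new [y] lies in [edom h], hence in [Omega], so projecting
    the extrapolated point can only bring it closer. *)
Lemma linked_step s z : mfista_inv s -> edom h z -> linked (step s) (next_u s) z.
Proof.
move=> si dz; have [dy _] := step_y_prox s si; have [_ dy1 a1 _] := si.
have [_ aa] := step_aP s a1.
have a0 : 0 < step_a s by lra.
have ai : (step_a s)^-1 <= 1 by rewrite invf_le1//; lra.
have [dw _] := econvex_segment h (step_y f h L s) z _ (h_proper assumptions)
  (h_convex assumptions) dy dz (ltW (etrans (invr_gt0 _) a0)) ai.
apply: le_trans (proj_nonexpansive _ _ _ (Omega_convex assumptions)
  (Omega_closed assumptions) (dOmega _ dw)) _.
rewrite /= /next_u; move: (step_y f h L s) (st_y s) (step_a s) a0 => y' y b b0.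
have -> : enorm (z - (y + st_a s *: (y' - y))) / b
  = enorm (b^-1 *: (z - (y + st_a s *: (y' - y)))).
  by rewrite enormZ ger0_norm ?invr_ge0 ?ltW// mulrC.
suff -> : b^-1 *: z + (1 - b^-1) *: y' - (y' + (st_a s - 1) / b *: (y' - y))
  = b^-1 *: (z - (y + st_a s *: (y' - y))) by [].
apply/rowP => i; rewrite !mxE; field; lra.
Qed.

(** The proximal inequality at [w = z / a + (1 - 1 / a) y], multiplied by [a^2]: convexity bounds
    the objective at [w], [linked] bounds [|w - x|], and [a (w - y')] is [z - next_u s], with [y']
    the new point. *)
Lemma energy_step s u z : mfista_inv s -> edom h z -> linked s u z ->
  st_a s ^+ 2 * (phi (step_y f h L s) - phi z)
    + 3 * L / 2 * (st_a s ^+ 2 * enorm (step_y f h L s - st_x s) ^+ 2)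
    + 2 * L * enorm (z - next_u s) ^+ 2
  <= (st_a s ^+ 2 - st_a s) * (phi (st_y s) - phi z) + 2 * L * enorm (z - u) ^+ 2.
Proof.
move=> si dz; have [Ox dy1 a1 _] := si; rewrite /linked.
have a0 : 0 < st_a s by lra.
have ai : (st_a s)^-1 <= 1 by rewrite invf_le1.
have ai0 : 0 <= (st_a s)^-1 by rewrite invr_ge0 ltW.
have [dw hw] := econvex_segment h (st_y s) z _ (h_proper assumptions)
  (h_convex assumptions) dy1 dz ai0 ai.
have fw := f_convex (Itv01 ai0 ai) _ _ (mem_set (dOmega _ dz)) (mem_set (dOmega _ dy1)).
have := prox_inequality s _ si dw; move: hw fw.
rewrite convRE {1}/conv/= /unstable.onem /phi.
have -> : z - next_u s = st_a s *: ((st_a s)^-1 *: z + (1 - (st_a s)^-1) *: st_y s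
  - step_y f h L s).
  by apply/rowP => i; rewrite /next_u !mxE; field; lra.
rewrite enormZ (ger0_norm (ltW a0)).
set w := _ *: z + _; move: (step_y f h L s) => y'.
move: (fine _) (fine _) (fine _) (fine _) => hy' hy hz hw hwle fwle prox link.
have linkL := ler_wpM2l (mulr_ge0 (ler0n R 2) (ltW (L_gt0 assumptions))) link.
have key : f y' + hy' + 3 * L / 2 * enorm (y' - st_x s) ^+ 2
    + 2 * L * enorm (w - y') ^+ 2
  <= (st_a s)^-1 * (f z + hz) + (1 - (st_a s)^-1) * (f (st_y s) + hy)
    + 2 * L * (enorm (z - u) / st_a s) ^+ 2 by lra.
have := ler_wpM2l (sqr_ge0 (st_a s)) key.
rewrite (_ : _ * (_ + 2 * L * (_ / _) ^+ 2) = st_a s * (f z + hz)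
    + (st_a s ^+ 2 - st_a s) * (f (st_y s) + hy) + 2 * L * enorm (z - u) ^+ 2).
  by move=> ?; lra.
by field; lra.
Qed.

Let st k := iter k step (mfista_init y0).

Lemma mfista_inv_iter k : mfista_inv (st k).
Proof.
by elim: k => [|k IH]; [exact: mfista_inv_init|exact: mfista_inv_step].
Qed.

Lemma st_a_ge k : 1 + k%:R / 2 <= st_a (st k).
Proof.
elim: k => [|k IH]; first by rewrite /= mul0r addr0.
have [_ _ a1 _] := mfista_inv_iter k; have [_] := step_aP _ a1.
rewrite -[k.+1%:R]natr1 => ?; change (1 + (k%:R + 1) / 2 <= step_a (st k)); lra.
Qed.

Lemma energy_iter z k : edom h z ->
  exists2 u, linked (st k) u z &
    (st_a (st k) ^+ 2 - st_a (st k)) * (phi (st_y (st k)) - phi z)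
      + 2 * L * enorm (z - u) ^+ 2
      + 3 * L / 2 * \sum_(i < k) st_a (st i) ^+ 2
          * enorm (step_y f h L (st i) - st_x (st i)) ^+ 2
    <= 2 * L * enorm (z - y0) ^+ 2.
Proof.
move=> dz; elim: k => [|k [u lk IH]].
  (* Initially [a = 1], so the objective gap has coefficient 0. *)
  exists y0; first by rewrite /linked /= invr1 mulr1 scale1r subrr scale0r addr0.
  by rewrite /= big_ord0; lra.
exists (next_u (st k)); first exact: linked_step (mfista_inv_iter k) dz.
have := energy_step _ _ _ (mfista_inv_iter k) dz lk.
have [_ _ a1 _] := mfista_inv_iter k.
(* The recurrence for [a] is what makes consecutive energies telescope. *)
have aE : st_a (st k.+1) ^+ 2 - st_a (st k.+1) = st_a (st k) ^+ 2.
  by have [<- _] := step_aP _ a1; rewrite mulrBr mulr1.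
have yE : st_y (st k.+1) = step_y f h L (st k) by [].
by rewrite aE yE big_ord_recr/= => ?; lra.
Qed.

Lemma step_v_le s : mfista_inv s ->
  enorm (step_v f h L s) <= 5 * L * enorm (step_y f h L s - st_x s).
Proof.
move=> si; have [dy _] := step_y_prox s si; have [Ox _ _ L0] := si.
rewrite /step_v L0 scale0r addr0.
apply: le_trans (ler_enormD _ _) _.
have := grad_lipschitz assumptions (dOmega _ dy) Ox.
rewrite -(opprB (step_y _ _ _ _)) scalerN -scaleNr enormZ normrN.
by rewrite ger0_norm ?mulr_ge0 ?(ltW (L_gt0 assumptions))// => ?; lra.
Qed.

Lemma sum_step_v_bounded : exists B, forall k,
  \sum_(i < k) i.+1%:R ^+ 2 * enorm (step_v f h L (st i)) ^+ 2 <= B.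
Proof.
have [z dz zmin] := minimizer_exists.
have L0 := L_gt0 assumptions.
(* [100 L^2] is [(2 * 5 L)^2], from [i + 1 <= 2 a] and [|v| <= 5 L |y - x|]; [4 / 3] is [2 L] over
   [3 L / 2]. *)
exists (100 * L ^+ 2 * (4 / 3 * enorm (z - y0) ^+ 2)) => k.
have [u _] := energy_iter z k dz.
have [_ dy a1 _] := mfista_inv_iter k.
set S := \sum_(i < k) _ => H.
have S_le : S <= 4 / 3 * enorm (z - y0) ^+ 2.
  have : 0 <= (st_a (st k) ^+ 2 - st_a (st k)) * (phi (st_y (st k)) - phi z).
    by rewrite mulr_ge0// subr_ge0; [rewrite expr2 ler_peMl//; lra|exact: zmin].
  have : 0 <= 2 * L * enorm (z - u) ^+ 2.
    by rewrite mulr_ge0 ?sqr_ge0// mulr_ge0// ltW.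
  move=> ? ?; rewrite -(ler_pM2l (_ : 0 < 3 * L / 2)); last lra.
  lra.
apply: le_trans (ler_wpM2l (_ : 0 <= 100 * L ^+ 2) S_le); last first.
  by rewrite mulr_ge0// sqr_ge0.
rewrite mulr_sumr; apply: ler_sum => i _.
have := step_v_le _ (mfista_inv_iter i); have := st_a_ge i.
set r := enorm (_ - _); set v := enorm _ => ai vr.
have v0 : 0 <= v by exact: enorm_ge0.
have r0 : 0 <= r by exact: enorm_ge0.
rewrite [leRHS](_ : _ = (2 * st_a (st i)) ^+ 2 * (5 * L * r) ^+ 2); last by ring.
rewrite ler_pM ?sqr_ge0// ler_sqr ?nnegrE//; first by rewrite -natr1; lra.
- by have : 0 <= i%:R :> R; [exact: ler0n|lra].
- by rewrite mulr_ge0// mulr_ge0// ltW.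
Qed.

Lemma step_v_subdiff s : mfista_inv s ->
  [set grad f (step_y f h L s) + u | u in subdiff h (step_y f h L s)] (step_v f h L s).
Proof.
move=> si; have [_ sub] := step_y_prox s si; have [_ _ _ L0] := si.
exists ((4 * L) *: (st_x s - step_y f h L s) - grad f (st_x s)) => //.
by rewrite /step_v L0 scale0r addr0 [_ *: _ - _]addrC addrA.
Qed.

End mfista_convex.

(** * From a convergent weighted series to the stopping time *)

Section stopping_time.
Context {R : realType}.
Implicit Types (r : nat -> R) (eps : R).

(** [m] marks where the tail of the series falls below [delta / 3]. It is chosen before [eps] and
    [N], so that [m^3 eps^2] vanishes with [eps]. *)
Lemma cube_stopping_bound r (B : R) :
  (forall k, \sum_(i < k) i.+1%:R ^+ 2 * r i ^+ 2 <= B) ->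
  forall delta, 0 < delta -> exists m : nat, forall (N : nat) eps, 0 <= eps ->
    (forall k, (k < N)%N -> eps < r k) ->
    N%:R ^+ 3 * eps ^+ 2 <= delta + m%:R ^+ 3 * eps ^+ 2.
Proof.
move=> HB delta d0.
pose T k := \sum_(i < k) i.+1%:R ^+ 2 * r i ^+ 2.
have TS k : T k.+1 = T k + k.+1%:R ^+ 2 * r k ^+ 2 by rewrite /T big_ord_recr.
have supT : has_sup (range T).
  by split; [exists (T 0%N), 0%N|exists B => _ [k _ <-]; exact: HB].
have d3 : 0 < delta / 3 by rewrite divr_gt0.
have [_ [m _ <-] Tm] := sup_adherent d3 supT.
have Tle k : T k - T m <= delta / 3.
  have : T k <= sup (range T) by apply: sup_upper_bound => //; exists k.
  lra.
exists m => N eps e0 eN.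
have [Nm|mN] := leqP N m.
  rewrite ler_wpDl ?(ltW d0)// ler_wpM2r ?sqr_ge0// lerXn2r ?nnegrE ?ler0n//.
  by rewrite ler_nat.
have tele j : (m + j <= N)%N ->
    ((m + j)%:R ^+ 3 - m%:R ^+ 3) * eps ^+ 2 <= 3 * (T (m + j)%N - T m).
  elim: j => [|j IH]; first by rewrite addn0 !subrr mul0r mulr0.
  rewrite addnS => mjN; have := IH (ltnW mjN).
  rewrite TS -[(m + j).+1%:R]natr1.
  have := eN _ mjN; set rm := r _ => er.
  have : eps ^+ 2 <= rm ^+ 2 by rewrite ler_pXn2r ?nnegrE// ltW// (le_lt_trans e0).
  have : 0 <= (m + j)%:R :> R by exact: ler0n.
  move: (m + j)%:R => x x0 er2.
  (* Cubes telescope against the weights since [(x + 1)^3 - x^3 <= 3 (x + 1)^2]; this 3 cancels that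
     of [delta / 3]. *)
  have : ((x + 1) ^+ 3 - x ^+ 3) * eps ^+ 2 <= 3 * ((x + 1) ^+ 2 * rm ^+ 2).
    have -> : (x + 1) ^+ 3 - x ^+ 3 = 3 * x ^+ 2 + 3 * x + 1 by ring.
    have xx := sqr_ge0 x; rewrite mulrA; apply: ler_pM => //; first lra.
      exact: sqr_ge0.
    rewrite sqrrD1; lra.
  by move=> *; lra.
have := tele (N - m)%N; rewrite subnKC ?(ltnW mN)// => /(_ (leqnn _)).
have := Tle N; lra.
Qed.

Lemma little_o_stopping_time r (B : R) :
  (forall k, \sum_(i < k) i.+1%:R ^+ 2 * r i ^+ 2 <= B) ->
  exists J : R -> nat,
    (forall eps, 0 < eps -> r (J eps) <= eps /\ forall k, (k < J eps)%N -> eps < r k) /\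
    (J eps).+1%:R / eps `^ (- (2 / 3)) @[eps --> 0^'+] --> (0 : R^o).
Proof.
move=> HB.
(* The guard [0 < eps] sits under the quantifier so that choice yields a total [J], with 0 as
   default. If no index qualified, the cube bound would fail for large [N]. *)
have ex eps : exists j, 0 < eps -> r j <= eps /\ forall k, (k < j)%N -> eps < r k.
  have [e0|] := ltP 0 eps; last by exists 0%N.
  have exj : exists j, r j <= eps.
    apply: contrapT => /forallNP noj.
    have allr k : eps < r k by rewrite ltNge; apply/negP; exact: noj.
    have [m Hm] := cube_stopping_bound r B HB 1 ltr01.
    have e2 : 0 < eps ^+ 2 by rewrite exprn_gt0.
    set x := (1 + m%:R ^+ 3 * eps ^+ 2) / eps ^+ 2.
    have x0 : 0 < x by rewrite divr_gt0// ltr_wpDr// mulr_ge0 ?exprn_ge0// ltW.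
    have xN := archi_boundP (ltW x0); set N := Num.bound x in xN.
    have := Hm N eps (ltW e0) (fun k _ => allr k).
    apply/negP; rewrite -ltNge -ltr_pdivrMr// -/x (lt_le_trans xN)//.
    have N1 : 1 <= N%:R :> R by rewrite ler1n -(ltr_nat R) (lt_trans x0).
    by rewrite exprS ler_peMr// exprn_ege1.
  have [j jP jmin] := ex_minnP exj.
  exists j => _; split=> // k kj; rewrite ltNge; apply/negP => /jmin.
  by rewrite leqNgt kj.
have [J HJ] := choice ex.
exists J; split => //.
apply/cvgrPdist_le => eta eta0.
(* The contributions of [J eps] and of the extra 1 get [eta / 2] each, both compared after cubing,
   where [eps^(2/3)] becomes [eps^2]. *)
pose c := (eta / 2) ^+ 3.
have c0 : 0 < c by rewrite exprn_gt0// divr_gt0.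
have [m Hm] := cube_stopping_bound r B HB (c / 2) (divr_gt0 c0 (ltr0n _ 2)).
near=> eps.
have e0 : 0 < eps by [].
have e1 : eps <= 1 by near: eps; apply: nbhs_right_le.
have ec : eps <= c by near: eps; apply: nbhs_right_le.
(* This gives [m^3 eps^2 <= c / 2]; the added 1 keeps the denominator positive when [m = 0]. *)
have em : eps <= c / 2 / (m%:R ^+ 3 + 1).
  by near: eps; apply: nbhs_right_le; rewrite !divr_gt0// ltr_wpDl// exprn_ge0.
have [_ HJe] := HJ eps e0.
have := Hm _ _ (ltW e0) HJe.
rewrite sub0r normrN powRN invrK.
have p0 : 0 <= eps `^ (2 / 3) by exact: powR_ge0.
have p3 : (eps `^ (2 / 3)) ^+ 3 = eps ^+ 2.
  rewrite -powR_mulrn// -powRrM (_ : 2 / 3 * 3%:R = 2%:R); last by field.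
  by rewrite powR_mulrn// ltW.
move: (eps `^ (2 / 3)) p0 p3 => p p0 p3 NE.
have ee : eps ^+ 2 <= eps by rewrite expr2 ler_piMl// ltW.
have p_le : p <= eta / 2.
  rewrite -(@ler_pXn2r _ 3)// ?nnegrE ?divr_ge0 ?(ltW eta0)// p3 -/c; lra.
have Jp_le : (J eps)%:R * p <= eta / 2.
  rewrite -(@ler_pXn2r _ 3)// ?nnegrE ?divr_ge0 ?mulr_ge0 ?(ltW eta0)//.
  rewrite exprMn p3 -/c.
  have : m%:R ^+ 3 * eps ^+ 2 <= c / 2.
    have m0 : 0 <= m%:R ^+ 3 :> R by rewrite exprn_ge0.
    have := ler_wpM2l m0 ee.
    move: em; rewrite ler_pdivlMr ?ltr_wpDl// => ? ?; nra.
  lra.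
by rewrite ger0_norm ?mulr_ge0// -natr1 mulrDl mul1r; lra.
Unshelve. all: by end_near. Qed.

End stopping_time.
Theorem theorem4p4 (R : realType) (n : nat) (Omega : set 'rV[R]_n)
    (f : 'rV[R]_n -> R) (h : 'rV[R]_n -> \bar R) (L C : R) (y0 : 'rV[R]_n)
    (assumptions : problem_assumptions Omega f h L C)
    (f_convex : @convex_function R 'rV[R]_n Omega f)
    (y0_dom : edom h y0) :
  exists N : R -> nat,
    (forall eps : R, 0 < eps ->
       mfista_exits_at Omega f h L y0 eps (N eps) /\
       approx_solution f h eps (mfista_y Omega f h L y0 (N eps))
                               (mfista_v Omega f h L y0 (N eps))) /\
    (N eps)%:R / eps `^ (- (2 / 3)) @[eps --> 0^'+] --> (0 : R^o).
Proof.
have [B HB] := sum_step_v_bounded assumptions f_convex y0_dom.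
have [J [HJ Jo]] := little_o_stopping_time (fun k => enorm (mfista_v Omega f h L y0 k.+1)) B HB.
(* [J] counts from 0 while iterations count from 1, hence the successor. *)
exists (fun eps => (J eps).+1); split=> // eps e0; have [vJ lt_v] := HJ eps e0.
split; first by split=> // -[|k]//; exact: lt_v.
split=> //; apply: (step_v_subdiff assumptions).
exact: (mfista_inv_iter assumptions f_convex y0_dom).
Qed.
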